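(* Let $k\ge1$, $\boldsymbol\alpha\in\mathbb R^k$ with $\alpha_i>0$ for all $i$, $\mathbf s\in\mathbb R^k$, and let $n\ge0$ be an integer. Let $\mu'_n[\mathbf s,\boldsymbol\alpha]=\int_{\Delta^{k-1}}(\mathbf s\cdot\mathbf y)^n\,dD_{\boldsymbol\alpha}(\mathbf y)$. Then $$\mu_n'[\mathbf s,\boldsymbol\alpha]=\frac{n!}{\langle|\boldsymbol\alpha|_\bullet\rangle_n}\sum_{\substack{\mathbf m\in\mathbb N_0^k\\ |\mathbf m|_\bullet=n}}\frac{\mathbf s^{\mathbf m}}{\mathbf m!}\langle\boldsymbol\alpha\rangle_{\mathbf m}=\frac{n!}{\langle|\boldsymbol\alpha|_\bullet\rangle_n}\,Z_n\Big(\sum_{i=1}^ks_i^1\alpha_i,\dots,\sum_{i=1}^ks_i^n\alpha_i\Big).$$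
   Context: $|\mathbf y|_\bullet=y_1+\dots+y_k$, $\langle a\rangle_n=\Gamma(a+n)/\Gamma(a)$, $\langle\boldsymbol\alpha\rangle_{\mathbf m}=\prod_i\langle\alpha_i\rangle_{m_i}$, $\mathbf s^{\mathbf m}=\prod_is_i^{m_i}$, $\mathbf m!=\prod_im_i!$. $D_{\boldsymbol\alpha}$ is the Dirichlet distribution: the probability measure on $\Delta^{k-1}=\{\mathbf y\in\mathbb R^k:y_i\ge0,\sum_iy_i=1\}$ with density $\frac{\Gamma(|\boldsymbol\alpha|_\bullet)}{\prod_i\Gamma(\alpha_i)}\prod_iy_i^{\alpha_i-1}$ with respect to $dy_1\cdots dy_{k-1}$ ($\delta_1$ if $k=1$). $Z_n(t_1,\dots,t_n)=\frac1{n!}\sum_{\pi\in\mathfrak S_n}\prod_{i=1}^nt_i^{\lambda_i(\pi)}$ is the cycle index polynomial of the symmetric group $\mathfrak S_n$, $\lambda_i(\pi)$ being the number of cycles of length $i$ of $\pi$; $Z_0=1$. *)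

(* Defs.v *)
From HB Require Import structures.
From mathcomp Require Import all_boot all_order all_algebra perm.
From mathcomp Require Import all_classical all_reals all_analysis.
From mathcomp Require Import measurable_realfun.

Set Implicit Arguments.
Unset Strict Implicit.
Unset Printing Implicit Defensive.

Import Order.TTheory GRing.Theory Num.Theory.
Import numFieldNormedType.Exports.

Local Open Scope classical_set_scope.
Local Open Scope ring_scope.

(** [k.-tuple R], with the product sigma-algebra, plays the role of R^k. *)

Section lebesgue_tuple.
Variable R : realType.
Local Open Scope ereal_scope.

Definition tuple_cons n (p : measurableTypeR R * n.-tuple R) :
  n.+1.-tuple R := [tuple of (p.1 : R) :: p.2].

Definition tuple_uncons n (t : n.+1.-tuple R) :
  measurableTypeR R * n.-tuple R := (thead t, [tuple of behead t]).

Lemma tuple_consK n : cancel (@tuple_cons n) (@tuple_uncons n).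
Proof. by case=> x t; congr (_, _); apply/val_inj. Qed.

Lemma measurable_tuple_cons n : measurable_fun setT (@tuple_cons n).
Proof.
apply: (@measurable_cons _ _ _ R (fun p => p.1 : R) n (fun p => p.2)).
  exact: measurable_fst.
exact: measurable_snd.
Qed.

Lemma measurable_tuple_uncons n : measurable_fun setT (@tuple_uncons n).
Proof.
apply/measurable_fun_pairP; split; first exact: (@measurable_tnth _ R n.+1).
exact: measurable_behead.
Qed.

Section step.
Variables (n : nat) (mu : {sigma_finite_measure set (n.-tuple R) -> \bar R}).

Definition lebesgue_tuple_step : set (n.+1.-tuple R) -> \bar R :=
  pushforward (lebesgue_measure \x mu) (@tuple_cons n).

Let m := [the {measure set _ -> \bar R} of lebesgue_measure \x mu].

Let step0 : lebesgue_tuple_step set0 = 0.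
Proof. by rewrite /lebesgue_tuple_step /pushforward preimage_set0 measure0. Qed.

Let step_ge0 A : 0 <= lebesgue_tuple_step A.
Proof. exact: (measure_ge0 m). Qed.

Let step_sigma_additive : semi_sigma_additive lebesgue_tuple_step.
Proof.
move=> F mF tF mUF; rewrite /lebesgue_tuple_step /pushforward preimage_bigcup.
apply: (@measure_semi_sigma_additive _ _ _ m).
- by move=> i; rewrite -[X in measurable X]setTI; exact: measurable_tuple_cons.
- apply/trivIsetP => /= i j _ _ ij; rewrite -preimage_setI.
  by move/trivIsetP : tF => /(_ _ _ _ _ ij) ->//; rewrite preimage_set0.
- rewrite -preimage_bigcup -[X in measurable X]setTI.
  exact: measurable_tuple_cons.
Qed.

HB.instance Definition _ := isMeasure.Build _ _ _ lebesgue_tuple_step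
  step0 step_ge0 step_sigma_additive.

Let step_sigma_finite : sigma_finite setT lebesgue_tuple_step.
Proof.
have /sigma_finiteP[F [TF ndF Foo]] := sigma_finiteT (@lebesgue_measure R).
have /sigma_finiteP[G [TG ndG Goo]] := sigma_finiteT mu.
exists (fun i => @tuple_uncons n @^-1` (F i `*` G i)).
  apply/esym; rewrite -subTset => t _.
  have [i _ Fi] : (\bigcup_i F i) (thead t) by rewrite -TF.
  have [j _ Gj] : (\bigcup_j G j) [tuple of behead t] by rewrite -TG.
  exists (maxn i j) => //; split => /=.
  - by move: Fi; apply/subsetPset/ndF/leq_maxl.
  - by move: Gj; apply/subsetPset/ndG/leq_maxr.
move=> i; have [mF Fi] := Foo i; have [mG Gi] := Goo i; split.
  rewrite -[X in measurable X]setTI.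
  by apply: measurable_tuple_uncons => //; exact: measurableX.
rewrite /lebesgue_tuple_step /pushforward -comp_preimage.
rewrite (_ : _ \o _ = id) ?preimage_id; last exact/funext/tuple_consK.
by rewrite product_measure1E// lte_mul_pinfty// ge0_fin_numE.
Qed.

HB.instance Definition _ := Measure_isSigmaFinite.Build _ _ _
  lebesgue_tuple_step step_sigma_finite.

End step.

(** The Lebesgue measure on R^n, as an iterated product of the one-dimensional
    one; on the one-point space R^0 it is the unit mass. *)
Fixpoint lebesgue_tuple n : {sigma_finite_measure set (n.-tuple R) -> \bar R} :=
  match n with
  | 0 => [the {sigma_finite_measure set (0.-tuple R) -> \bar R} of
            \d_([tuple] : 0.-tuple R)]
  | n'.+1 => [the {sigma_finite_measure set (n'.+1.-tuple R) -> \bar R} of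
            lebesgue_tuple_step (lebesgue_tuple n')]
  end.

End lebesgue_tuple.

Section gamma.
Variable R : realType.

(** Euler's integral; it converges for [0 < a], the only case of interest. *)
Definition Gamma (a : R) : R :=
  \int[lebesgue_measure]_(x in `]0%R, +oo[) (x `^ (a - 1) * expR (- x)).

Lemma Gamma_ge0 a : 0 <= Gamma a.
Proof.
rewrite /Gamma Rintegral_ge0// => x _.
by rewrite mulr_ge0 ?powR_ge0 ?expR_ge0.
Qed.

Definition rising (a : R) (n : nat) : R := Gamma (a + n%:R) / Gamma a.

End gamma.

Section dirichlet.
Variables (R : realType) (k : nat).
Implicit Types (alpha s y : k.-tuple R).

(** The simplex in R^k, thus of dimension [k - 1]. *)
Definition simplex : set (k.-tuple R) :=
  [set y | (forall i, 0 <= tnth y i) /\ \sum_(i < k) tnth y i = 1].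

(** (y_1, ..., y_{k-1}) |-> (y_1, ..., y_{k-1}, 1 - y_1 - ... - y_{k-1}) *)
Definition simplex_chart (t : k.-1.-tuple R) : k.-tuple R :=
  [tuple if (i < k.-1)%N then t`_i else 1 - \sum_(j < k.-1) tnth t j | i < k].

Definition dirichlet_density alpha y : R :=
  Gamma (\sum_(i < k) tnth alpha i) / (\prod_(i < k) Gamma (tnth alpha i)) *
  \prod_(i < k) tnth y i `^ (tnth alpha i - 1).

(** The density is with respect to dy_1 ... dy_{k-1}. *)
Definition dirichlet alpha : set (k.-tuple R) -> \bar R := fun A =>
  if k == 1%N then \d_([tuple 1 | _ < k] : k.-tuple R) A
  else (\int[@lebesgue_tuple R k.-1]_(t in simplex_chart @^-1` (A `&` simplex))
          (dirichlet_density alpha (simplex_chart t))%:E)%E.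

Lemma measurable_simplex : measurable simplex.
Proof.
rewrite (_ : simplex =
  (\bigcap_(i in [set: 'I_k]) ((@tnth k R)^~ i @^-1` `[0, +oo[%classic)) `&`
  ((fun y => \sum_(i < k) tnth y i) @^-1` [set 1])).
  apply: measurableI.
    apply: fin_bigcap_measurable => // i _.
    by rewrite -[X in measurable X]setTI; exact: (@measurable_tnth _ R k i).
  rewrite -[X in measurable X]setTI.
  apply: (@measurable_sum _ _ R) => //= i; exact: measurable_tnth.
apply/seteqP; split=> y [y0 y1]; split => //.
  by move=> i _ /=; rewrite in_itv/= andbT.
by move=> i; have := y0 i I; rewrite /= in_itv/= andbT.
Qed.

Lemma measurable_simplex_chart : measurable_fun setT simplex_chart.
Proof.
apply/measurable_fun_tnthP => i.
rewrite (_ : _ \o _ = fun t : k.-1.-tuple R => if (i < k.-1)%N then t`_i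
    else 1 - \sum_(j < k.-1) tnth t j); last first.
  by apply/funext => t /=; rewrite tnth_mktuple.
have [ik|_] := ltnP i k.-1; last first.
  apply: measurable_funB; first exact: measurable_cst.
  by apply: measurable_sum => j; exact: measurable_tnth.
rewrite (_ : (fun t : k.-1.-tuple R => _) = fun t => tnth t (Ordinal ik)).
  exact: measurable_tnth.
by apply/funext => t; rewrite (tnth_nth 0).
Qed.

Lemma dirichlet_density_ge0 alpha y : 0 <= dirichlet_density alpha y.
Proof.
rewrite /dirichlet_density mulr_ge0 ?divr_ge0 ?Gamma_ge0//.
  by apply: prodr_ge0 => i _; exact: Gamma_ge0.
by apply: prodr_ge0 => i _; exact: powR_ge0.
Qed.

Lemma measurable_dirichlet_density alpha :
  measurable_fun setT (dirichlet_density alpha).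
Proof.
apply: measurable_funM; first exact: measurable_cst.
apply: measurable_prod => i _.
apply: (measurableT_comp (measurable_powR _)); exact: measurable_tnth.
Qed.

Section dirichlet_measure.
Variable alpha : k.-tuple R.

Let dirichlet0 : dirichlet alpha set0 = 0%E.
Proof.
rewrite /dirichlet; case: ifP => _; first by rewrite measure0.
by rewrite set0I preimage_set0 integral_set0.
Qed.

Let dirichlet_ge0 A : (0 <= dirichlet alpha A)%E.
Proof.
rewrite /dirichlet; case: ifP => _; first exact: measure_ge0.
by apply: integral_ge0 => t _; rewrite lee_fin dirichlet_density_ge0.
Qed.

Let dirichlet_sigma_additive : semi_sigma_additive (dirichlet alpha).
Proof.
rewrite /dirichlet; case: (k == 1%N); first exact: measure_semi_sigma_additive.
move=> F mF tF mUF /=; rewrite setI_bigcupl preimage_bigcup.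
have mchart A : measurable A -> measurable (simplex_chart @^-1` A).
  by move=> mA; rewrite -[X in measurable X]setTI;
    exact: measurable_simplex_chart.
rewrite ge0_integral_bigcup//=.
- apply: is_cvg_ereal_nneg_natsum_cond => i _ _.
  by apply: integral_ge0 => t _; rewrite lee_fin dirichlet_density_ge0.
- by move=> i; apply: mchart; apply: measurableI => //;
    exact: measurable_simplex.
- apply: measurable_funTS; apply/measurable_EFinP.
  apply: measurableT_comp; first exact: measurable_dirichlet_density.
  exact: measurable_simplex_chart.
- by move=> t _; rewrite lee_fin dirichlet_density_ge0.
- apply/trivIsetP => i j _ _ ij; rewrite -preimage_setI setIACA.
  move/trivIsetP : tF => /(_ i j I I ij) ->.
  by rewrite set0I preimage_set0.
Qed.

HB.instance Definition _ := isMeasure.Build _ _ _ (dirichlet alpha)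
  dirichlet0 dirichlet_ge0 dirichlet_sigma_additive.

End dirichlet_measure.

(** The integral is taken in the extended reals, so that an equality with a
    real number carries the integrability of the integrand. *)
Definition dirichlet_moment (n : nat) s alpha : \bar R :=
  (\int[dirichlet alpha]_(y in simplex)
     ((\sum_(i < k) tnth s i * tnth y i) ^+ n)%:E)%E.

End dirichlet.

Section cycle_index.
Variable R : realType.

Definition ncycles n (i : nat) (p : 'S_n) : nat :=
  #|[set c in porbits p | #|c| == i]|%N.

(** Only the values [t 1], ..., [t n] matter. *)
Definition cycle_index (n : nat) (t : nat -> R) : R :=
  n`!%:R^-1 * \sum_(p : 'S_n) \prod_(1 <= i < n.+1) t i ^+ ncycles i p.

End cycle_index.

(* Main.v *)
Require Import Defs.
From mathcomp Require Import all_boot all_order all_algebra perm.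
From mathcomp Require Import boolp reals ring.

(** All three members of the theorem, multiplied by the rising factorial
    <|alpha|>_n, are the same number [urn alpha [:: s; ...; s]], which is attached
    to Polya's urn started with [alpha_i] balls of colour [i] and defined by

      urn a [::] = 1,   urn a (x :: r) = sum_i a_i x_i urn (a + e_i) r.

    The moment. By the functional equation of Gamma, y_i times the density of
    D_alpha is alpha_i / |alpha| times the density of D_(alpha + e_i)
    ([dirichlet_density_add_ball]). Expanding one factor of (s . y)^(n+1) thus
    turns the moment of order n+1 into a combination of moments of order n with
    one more ball ([dirichlet_momentS]). The recurrence starts because D_alpha
    has mass 1: this is Dirichlet's integral ([integral_simplex_weight]), which
    is computed one coordinate at a time, each step being the convolution of two
    power functions; the constants are Beta integrals, and these are quotients
    of Gamma values by Tonelli's theorem ([egammaM]).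

    The sum over multi-indices. Multiplied by n + 1 = m_1 + ... + m_k, the
    sum of order n + 1 splits into k sums in which m_i can be lowered by one;
    this is the recurrence of the urn again ([urn_multi_index]).

    The cycle index. A permutation of a set with one more point x arises from a
    permutation of the set either by letting x be fixed or by inserting x in a
    cycle, just before some point y. To follow the weights, let each point t
    carry a vector v_t of its own and let a cycle C have the weight
    sum_i a_i prod_(t in C) v_t(i), which is the power sum of the cycle index
    when all v_t are s. Inserting x before y has the effect of multiplying v_y
    by v_x, so the sum W over all permutations satisfies

      W(x, A; v) = (sum_i a_i v_x(i)) W(A; v) + sum_(y in A) W(A; v, v_y := v_x v_y)

    ([cycles_sum_insert]). The urn satisfies the same identity
    ([urn_cons_absorb]), because its draws are exchangeable. *)

Set Implicit Arguments.
Unset Strict Implicit.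
Unset Printing Implicit Defensive.

Import Order.TTheory GRing.Theory Num.Theory.
Local Open Scope ring_scope.

(** * Polya's urn *)

Section urn.
Variables (R : comPzRingType) (k : nat).
Implicit Types (a x : 'I_k -> R).

Definition add_ball a (i : 'I_k) : 'I_k -> R := fun j => a j + (j == i)%:R.

(** Polya's urn: with weights [a], drawing colour [i] has probability
    proportional to [a i] and adds a ball of that colour. Up to the factor
    <|a|>_n, this is the expectation of the product of the [x_t (c_t)], where
    [c_t] is the colour of the t-th draw. *)
Fixpoint urn a (xs : seq ('I_k -> R)) : R :=
  if xs is x :: r then \sum_i a i * x i * urn (add_ball a i) r else 1.

End urn.

Section urn_insertion.
Variables (R : comPzRingType) (k : nat) (T : finType).
Implicit Types (a : 'I_k -> R) (v : T -> 'I_k -> R) (x y : T) (A C : {set T}).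

(** The vectors left when the cycle through [y] swallows the point [x]. *)
Definition absorb v x y : T -> 'I_k -> R :=
  fun z i => if z == y then v z i * v x i else v z i.

Lemma add_ballC a i j : add_ball (add_ball a i) j = add_ball (add_ball a j) i.
Proof. by apply/funext => l; rewrite /add_ball addrAC. Qed.

Lemma sum_add_ballM a i (f : 'I_k -> R) :
  \sum_j add_ball a i j * f j = \sum_j a j * f j + f i.
Proof.
under eq_bigr do rewrite /add_ball mulrDl.
rewrite big_split/=; congr (_ + _); rewrite (bigD1 i)//= eqxx mul1r.
by rewrite big1 ?addr0// => j /negbTE ->; rewrite mul0r.
Qed.

Lemma map_absorb_notin v x y (r : seq T) :
  y \notin r -> map (absorb v x y) r = map v r.
Proof.
move=> yr; apply/eq_in_map => z zr; apply/funext => i; rewrite /absorb.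
by case: eqP => // zy; rewrite -zy zr in yr.
Qed.

(** The urn recurrence peels off the first draw and changes the weights; this
    one keeps the weights fixed, and so can be compared with permutations. It
    says that the first draw may be treated as if it came last: its colour is
    then chosen either from the original balls, or by copying the colour of
    one of the other draws, whose vector it multiplies. *)
Lemma urn_cons_absorb a v x (r : seq T) : uniq r ->
  urn a (v x :: map v r) =
  (\sum_i a i * v x i) * urn a (map v r) +
  \sum_(y <- r) urn a (map (absorb v x y) r).
Proof.
elim: r a => [|u r ih] a.
  rewrite big_nil addr0 /= mulr1 => _.
  by apply: eq_bigr => i _; rewrite mulr1.
move=> /= /andP[ur unr].
(* The first two draws are exchangeable, which lets the induction hypothesis
   act on the draws that follow [u]. *)
transitivity (\sum_l a l * v u l * urn (add_ball a l) (v x :: map v r)).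
  under eq_bigr do rewrite mulr_sumr.
  rewrite exchange_big/=; apply: eq_bigr => l _.
  rewrite mulr_sumr; apply: eq_bigr => i _.
  rewrite (add_ballC _ i l) !mulrA; congr (_ * _); rewrite /add_ball (eq_sym i l).
  by case: eqVneq => [->|_] /=; ring.
rewrite (eq_bigr (fun l => a l * v u l *
    ((\sum_i a i * v x i + v x l) * urn (add_ball a l) (map v r) +
     \sum_(y <- r) urn (add_ball a l) (map (absorb v x y) r)))); last first.
  by move=> l _; rewrite ih// sum_add_ballM.
under eq_bigr do rewrite mulrDl 2!mulrDr.
rewrite !big_split/= big_cons map_absorb_notin// -addrA; congr (_ + (_ + _)).
- by rewrite mulr_sumr; apply: eq_bigr => l _; rewrite mulrCA mulrA.
- by apply: eq_bigr => l _; rewrite /absorb eqxx !mulrA.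
- under eq_bigr do rewrite mulr_sumr.
  rewrite exchange_big/= big_seq [RHS]big_seq; apply: eq_bigr => y yr.
  apply: eq_bigr => l _; rewrite /absorb; case: eqVneq => // uy.
  by rewrite uy yr in ur.
Qed.

End urn_insertion.

(** * Cycles of permutations *)

Section cycle_insertion.
Variable T : finType.
Implicit Types (x y z : T) (A C : {set T}) (q : {perm T}).
Local Open Scope group_scope.

Lemma porbit_stable q C z : (forall u, u \in C -> q u \in C) ->
  z \in C -> porbit q z \subset C.
Proof.
move=> qC zC; apply/subsetP => _ /porbitP[i ->].
by elim: i => [|i ih]; rewrite ?perm1// expgSr permM qC.
Qed.

Lemma porbit_step q z u : u \in porbit q z -> q u \in porbit q z.
Proof. by case/porbitP => i ->; apply/porbitP; exists i.+1; rewrite expgSr permM. Qed.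

Lemma porbit_fixed q x : q x = x -> porbit q x = [set x].
Proof.
move=> qx; apply/eqP; rewrite eqEsubset sub1set porbit_id andbT.
by apply: porbit_stable => [u|]; rewrite !inE// => /eqP ->; rewrite qx.
Qed.

Lemma fixed_notin_porbit q x z : q x = x -> z != x -> x \notin porbit q z.
Proof. by move=> qx zx; rewrite porbit_sym porbit_fixed// inE. Qed.

(** The effect of [q |-> q * tperm x y] on the cycles of [q] other than [x]. *)
Definition insert_in_cycle x y C := if y \in C then x |: C else C.

(** Since [q * tperm x y] sends [x] to [y] and the former preimage of [y] to
    [x], it inserts [x] just before [y] in the cycle of [y] and leaves the other
    cycles alone. Both inclusions hold because a cycle is the least stable set
    containing a given point. *)
Lemma porbit_insert q x y z : q x = x -> x != y -> z != x ->
  porbit (q * tperm x y) z = insert_in_cycle x y (porbit q z).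
Proof.
move=> qx xy zx; set p := _ * _.
have px : p x = y by rewrite permM qx tpermL.
have pE u : u != x -> p u = if q u == y then x else q u.
  move=> ux; rewrite permM; case: tpermP => [qu|->|_ /eqP/negbTE ->//].
    by rewrite -qx in qu; rewrite (perm_inj qu) eqxx in ux.
  by rewrite eqxx.
have qE u : u != x -> q u != x.
  by apply: contra_neq => qu; apply: (@perm_inj _ q); rewrite qx.
have xz : x \notin porbit q z by exact: fixed_notin_porbit.
have zxy : porbit q z \subset porbit p z :\ x.
  apply: porbit_stable => [u|]; rewrite !inE ?zx ?porbit_id//.
  move=> /andP[ux uz]; rewrite qE//=; have := porbit_step uz.
  rewrite pE//; case: eqP => [qu|//]; move/porbit_step.
  by rewrite px qu.
apply/eqP; rewrite eqEsubset; apply/andP; split.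
  apply: porbit_stable => [u|]; rewrite /insert_in_cycle; last first.
    by case: ifP => _; rewrite ?inE porbit_id ?orbT.
  case: ifPn => yC.
    rewrite !inE => /predU1P[->|uC]; first by rewrite px yC orbT.
    have [->|ux] := eqVneq u x; first by rewrite px yC orbT.
    by rewrite pE//; case: ifP => _; rewrite ?eqxx// porbit_step ?orbT.
  move=> uC; have ux : u != x by apply: contraNneq xz => <-.
  by rewrite pE// ifN ?porbit_step//; apply: contraNneq yC => <-; exact: porbit_step.
rewrite /insert_in_cycle; case: ifPn => yC; last first.
  by apply: subset_trans zxy _; exact: subsetDl.
rewrite subUset (subset_trans zxy) ?subsetDl// andbT sub1set.
have : y \in porbit p z by have /subsetP/(_ _ yC) := zxy; rewrite inE => /andP[].
by rewrite -!eq_porbit_mem -px -(porbit_perm p 1 x) expg1.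
Qed.

End cycle_insertion.

Section cycle_weights.
Variables (R : comPzRingType) (k : nat) (T : finType).
Variable a : 'I_k -> R.
Implicit Types (v : T -> 'I_k -> R) (x y z : T) (A C : {set T}) (p q : {perm T}).

(** Giving every point its own vector [v t], instead of the common vector [s]
    of the cycle index, is what makes the insertion of a point expressible: it
    multiplies one of the vectors. *)
Definition cycle_weight v C : R := \sum_i a i * \prod_(t in C) v t i.

(** For [p] supported in [A], the restriction [C \subset A] discards the fixed
    points outside [A] and nothing else. *)
Definition cycles_weight v A p : R :=
  \prod_(C in porbits p | C \subset A) cycle_weight v C.

Lemma cycle_weight_insert v x y C : x \notin C ->
  cycle_weight v (insert_in_cycle x y C) = cycle_weight (absorb v x y) C.
Proof.
move=> xC; apply: eq_bigr => i _; congr (_ * _); rewrite /insert_in_cycle.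
case: ifPn => yC; last first.
  apply: eq_bigr => z zC; rewrite /absorb; case: eqP => // zy.
  by rewrite -zy zC in yC.
rewrite big_setU1//= (big_setD1 y)//= [in RHS](big_setD1 y)//= /absorb eqxx.
rewrite mulrCA mulrA; congr (_ * _).
by apply: eq_bigr => z; rewrite !inE => /andP[/negbTE ->].
Qed.

Lemma cycles_weight_fixed v x A q : x \notin A -> q x = x ->
  cycles_weight v (x |: A) q = (\sum_i a i * v x i) * cycles_weight v A q.
Proof.
move=> xA qx.
have porbit_x := porbit_fixed qx.
rewrite /cycles_weight (bigD1 [set x])/=; last first.
  by rewrite sub1set setU11 andbT -porbit_x imset_f.
congr (_ * _).
  by apply: eq_bigr => i _; rewrite big_set1.
apply: eq_bigl => C; rewrite -andbA; case: imsetP => //= -[z _ ->{C}].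
apply/andP/idP => [[sub Cx]|sub]; last first.
  split; first exact: subset_trans sub (subsetUr _ _).
  by apply: contraTneq sub => ->; rewrite sub1set.
apply/subsetP => u uz; have /subsetP/(_ _ uz) := sub.
rewrite !inE => /predU1P[ux|//].
move: uz; rewrite ux -eq_porbit_mem porbit_x => /eqP zx.
by rewrite zx eqxx in Cx.
Qed.

Lemma cycles_weight_insert v x y A q : x \notin A -> y \in A -> perm_on A q ->
  cycles_weight v (x |: A) (q * tperm x y)%g = cycles_weight (absorb v x y) A q.
Proof.
move=> xA yA qA; have qx : q x = x by exact: (out_perm qA).
have xy : x != y by apply: contraNneq xA => ->.
set p := (_ * _)%g; pose F := insert_in_cycle x y.
pose S := [set C in porbits q | C \subset A].
have xS C : C \in S -> x \notin C.
  by rewrite inE => /andP[_ /subsetP CA]; apply: contraNN xA => /CA.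
have px : p x = y by rewrite permM qx tpermL.
(* The cycles of [p] inside [x |: A] are those of [q] inside [A], one of them
   enlarged by [x]. *)
have SE : [set C in porbits p | C \subset x |: A] = F @: S.
  apply/setP => C; rewrite inE; apply/andP/imsetP.
    case=> /imsetP[z _ ->{C}].
    wlog zx : z / z != x.
      move=> wl; have [->|] := eqVneq z x; last exact: wl.
      have -> : porbit p x = porbit p y by rewrite -px -(porbit_perm p 1 x) expg1.
      by apply: wl; rewrite eq_sym.
    rewrite porbit_insert// => sub; exists (porbit q z) => //.
    rewrite inE imset_f//=.
    have xz : x \notin porbit q z by exact: fixed_notin_porbit.
    apply/subsetP => u uz; have : u \in F (porbit q z).
      by rewrite /F /insert_in_cycle; case: ifP; rewrite ?inE uz ?orbT.
    move/(subsetP sub); rewrite !inE => /predU1P[ux|//].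
    by rewrite -ux uz in xz.
  case=> C' C'S ->{C}; have xC' := xS _ C'S.
  move: C'S; rewrite inE => /andP[/imsetP[z _ C'E] C'A].
  have zx : z != x by apply: contraNneq xC' => <-; rewrite C'E porbit_id.
  rewrite {1}C'E /F -porbit_insert// imset_f//; split => //.
  rewrite /F /insert_in_cycle; case: ifP => _.
    by rewrite setUS.
  exact: subset_trans C'A (subsetUr _ _).
have FK C : x \notin C -> F C :\ x = C.
  move=> xC; rewrite /F /insert_in_cycle; case: ifP => _; first exact: setU1K.
  by apply/setDidPl; rewrite disjoint_sym disjoints1.
transitivity (\prod_(C in F @: S) cycle_weight v C).
  by apply: eq_bigl => C; rewrite -SE inE.
rewrite big_imset/=; last first.
  by move=> C1 C2 C1S C2S /(congr1 (fun C => C :\ x)); rewrite !FK// xS.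
rewrite /cycles_weight; apply: eq_big => [C|C CS]; first by rewrite inE.
by apply: cycle_weight_insert; exact: xS.
Qed.

Definition cycles_sum v A : R := \sum_(p | perm_on A p) cycles_weight v A p.

Lemma cycles_sum0 v : cycles_sum v set0 = 1.
Proof.
rewrite /cycles_sum (big_pred1 (1%g : {perm T})) => [|p /=].
  rewrite /cycles_weight big1// => C /andP[/imsetP[z _ ->] /subsetP/(_ z)].
  by rewrite porbit_id inE => /(_ isT).
apply/idP/eqP => [p0|->]; last exact: perm_on1.
by apply/permP => z; rewrite perm1 (out_perm p0)// inE.
Qed.

(** Classify the permutations [p] of [x |: A] by [y = p x]: composing with
    [tperm x y] turns them into permutations of [A], from which [p] is recovered
    by adding [x] as a fixed point if [y = x], and by inserting it before [y]
    otherwise. *)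
Lemma cycles_sum_insert v x A : x \notin A ->
  cycles_sum v (x |: A) = (\sum_i a i * v x i) * cycles_sum v A +
    \sum_(y in A) cycles_sum (absorb v x y) A.
Proof.
move=> xA.
have moved y : y \in x |: A ->
    \sum_(p | perm_on (x |: A) p && (p x == y)) cycles_weight v (x |: A) p =
    \sum_(q | perm_on A q) cycles_weight v (x |: A) (q * tperm x y)%g.
  move=> yA.
  have tK : involutive (fun q : {perm T} => (q * tperm x y)%g).
    by move=> q; rewrite -mulgA tperm2 mulg1.
  rewrite (reindex_inj (inv_inj tK)); apply: eq_bigl => q /=.
  rewrite permM -[in X in _ == X](tpermL x y) (inj_eq perm_inj).
  have tA : perm_on (x |: A) (tperm x y).
    apply/subsetP => z; rewrite inE; case: tpermP => [->|->|]; rewrite ?setU11//.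
    by rewrite eqxx.
  apply/andP/idP => [[qA /eqP qx]|qA].
    apply/subsetP => z; rewrite inE => qz.
    have : z \in x |: A.
      apply: contraNT qz => zA; rewrite -(tK q).
      by rewrite permM (out_perm qA zA) (out_perm tA zA).
    by rewrite !inE => /predU1P[zx|//]; rewrite zx qx eqxx in qz.
  rewrite (out_perm qA)//; split=> //; apply: perm_onM tA.
  by apply: subset_trans qA _; exact: subsetUr.
rewrite /cycles_sum (partition_big (fun p => p x) [in x |: A])/=; last first.
  by move=> p pA; rewrite (perm_closed _ pA) setU11.
rewrite big_setU1//=; congr (_ + _).
  rewrite moved ?setU11// mulr_sumr; apply: eq_bigr => q qA.
  by rewrite tperm1 mulg1 cycles_weight_fixed// (out_perm qA).
apply: eq_bigr => y yA; rewrite moved ?setU1r//; apply: eq_bigr => q qA.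
exact: cycles_weight_insert.
Qed.

(** Both sides satisfy the same recurrence, [cycles_sum_insert] on the left and
    [urn_cons_absorb] on the right. *)
Lemma cycles_sum_urn v (r : seq T) : uniq r ->
  cycles_sum v [set z in r] = urn a (map v r).
Proof.
elim: r v => [|x r ih] v /=; first by rewrite set_nil cycles_sum0.
move=> /andP[xr ur]; rewrite set_cons cycles_sum_insert ?inE// ih//.
rewrite -/(urn a (v x :: map v r)) urn_cons_absorb//; congr (_ + _).
by rewrite [RHS]big_uniq//=; apply: eq_big => [y|y _]; rewrite ?inE ?ih.
Qed.

End cycle_weights.

Lemma prod_porbits_card (R : comPzRingType) n (p : 'S_n) (f : nat -> R) :
  \prod_(C in porbits p) f #|C| = \prod_(1 <= i < n.+1) f i ^+ ncycles i p.
Proof.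
transitivity (\prod_(1 <= i < n.+1) \prod_(C in porbits p | #|C| == i) f #|C|).
  rewrite (exchange_big_dep (mem (porbits p)))//=;
    last by move=> i C _ /andP[].
  apply: eq_bigr => C Cp.
  rewrite (eq_bigl (fun i => i == #|C|)) => [|i]; last by rewrite Cp eq_sym.
  have := max_card C; rewrite card_ord big_nat1_eq ltnS => ->; rewrite andbT ifT//.
  by case/imsetP: Cp => z _ ->; rewrite lt0n card_porbit_neq0.
apply: eq_bigr => i _; rewrite (eq_bigr (fun=> f i)) => [|C /andP[_ /eqP ->]//].
by rewrite prodr_const; congr (_ ^+ _); apply: eq_card => C; rewrite !inE.
Qed.

(** When every point carries the vector [s], the weight of a cycle only depends on
    its length and is the corresponding argument of the cycle index. *)
Lemma cycle_index_urn (R : realType) k n (a s : 'I_k -> R) :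
  n`!%:R * cycle_index n (fun j => \sum_i s i ^+ j * a i) = urn a (nseq n s).
Proof.
have -> : nseq n s = map (fun=> s) (enum 'I_n).
  by rewrite -[in LHS](size_enum_ord n); elim: (enum _) => //= _ l ->.
rewrite -cycles_sum_urn ?enum_uniq// /cycle_index mulVKf; last first.
  by rewrite pnatr_eq0 -lt0n fact_gt0.
have -> : [set z in enum 'I_n] = setT by apply/setP => z; rewrite !inE mem_enum.
rewrite /cycles_sum; apply: eq_big => [p|p _].
  by apply/esym/subsetP => z; rewrite inE.
rewrite -prod_porbits_card /cycles_weight; apply: eq_big => [C|C _].
  by rewrite subsetT andbT.
by apply: eq_bigr => i _; rewrite prodr_const mulrC.
Qed.

(** * Beta and Gamma integrals *)

From mathcomp Require Import all_classical all_reals all_analysis.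
From mathcomp Require Import measurable_realfun.

Import Order.TTheory GRing.Theory Num.Theory.
Import numFieldNormedType.Exports.
Local Open Scope classical_set_scope.
Local Open Scope ring_scope.

Section affine.
Variable R : realType.
Local Notation mu := (@lebesgue_measure R).
Local Open Scope ereal_scope.

Variables (c d : R) (c0 : (0 < c)%R).
Let phi (x : measurableTypeR R) : measurableTypeR R := (c * x + d)%R.

Let mphi : measurable_fun setT phi.
Proof. by apply: measurable_funD => //; exact: measurable_funM. Qed.

Let nu := mscale (NngNum (ltW c0))
  (measure_function_pushforward__canonical__measure_function_Measure mu mphi).

Lemma lebesgue_measure_affine (A : set R) : measurable A ->
  mu A = c%:E * pushforward mu phi A.
Proof.
move=> mA.
rewrite (_ : _ * _ = nu A)//.
apply: lebesgue_measure_unique => //= _ [[a b]] _ <-.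
rewrite /nu /mscale /= /pushforward.
rewrite (_ : phi @^-1` _ = `](a - d) / c, (b - d) / c]%classic)%R; last first.
  apply/seteqP; split => x /=; rewrite !in_itv/= ltr_pdivrMr// ler_pdivlMr// /phi;
    by rewrite ltrBlDr lerBrDr mulrC.
rewrite !lebesgue_measure_itv/= !lte_fin ltr_pM2r ?invr_gt0// ltrD2r.
case: ifPn => ab; last by rewrite mule0.
by rewrite -EFinM/=; congr EFin; field; rewrite gt_eqF.
Qed.

Lemma ge0_integral_affine (f : R -> \bar R) : measurable_fun setT f ->
  (forall x, 0 <= f x) -> \int[mu]_x f x = c%:E * \int[mu]_x f (c * x + d)%R.
Proof.
move=> mf f0.
transitivity (\int[nu]_x f x).
  by apply: eq_measure_integral => A mA _; exact: lebesgue_measure_affine.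
by rewrite ge0_integral_mscale//= ge0_integral_pushforward.
Qed.

End affine.

Section beta_gamma.
Variable R : realType.
Local Notation mu := (@lebesgue_measure R).
Implicit Types a b c x y : R.

Lemma eq_integral_off_point c (f1 f2 : measurableTypeR R -> \bar R) :
  measurable_fun setT f1 -> measurable_fun setT f2 ->
  (forall x, x != c -> f1 x = f2 x) ->
  (\int[mu]_x f1 x = \int[mu]_x f2 x)%E.
Proof.
move=> mf1 mf2 f12; apply: ae_eq_integral => //.
exists [set c]; split; [exact: measurable_set1|exact: lebesgue_measure_set1|].
move=> x /= nf12; apply: contrapT => xc; apply: nf12 => _.
by apply: f12; apply/eqP.
Qed.

(** The kernel from which the Gamma, Beta and Dirichlet densities are all made.
    The endpoint 0 is kept, so that the support of a Dirichlet density is the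
    closed simplex. For [a < 1] the value there is a convention, so identities
    between convolutions of kernels are only claimed away from 0. *)
Definition power_density a x : R := if 0 <= x then x `^ (a - 1) else 0.
Local Notation g := power_density.

Lemma power_density_ge0 a x : 0 <= g a x.
Proof. by rewrite /g; case: ifP => // _; exact: powR_ge0. Qed.

Lemma measurable_power_density a : measurable_fun setT (g a).
Proof.
apply: measurable_fun_ifT.
- exact: measurable_fun_ler.
- exact: measurable_powR.
- exact: measurable_cst.
Qed.

Lemma power_density_lt0 a x : x < 0 -> g a x = 0.
Proof. by move=> x0; rewrite /g leNgt x0. Qed.

Lemma power_densityM a c x : 0 < c -> g a (c * x) = c `^ (a - 1) * g a x.
Proof.
move=> c0; rewrite /g pmulr_rge0//; case: ifPn => x0; last by rewrite mulr0.
by rewrite powRM// ltW.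
Qed.

(** Extended-real forms of Euler's integrals, usable before they are known to
    converge. *)
Definition ebeta a b : \bar R := (\int[mu]_x (g a x * g b (1 - x))%:E)%E.

Definition egamma a : \bar R := (\int[mu]_x (g a x * expR (- x))%:E)%E.

Lemma egamma_ge0 a : (0 <= egamma a)%E.
Proof.
by apply: integral_ge0 => x _; rewrite lee_fin mulr_ge0 ?power_density_ge0 ?expR_ge0.
Qed.

Lemma ebeta_ge0 a b : (0 <= ebeta a b)%E.
Proof.
by apply: integral_ge0 => x _; rewrite lee_fin mulr_ge0 ?power_density_ge0.
Qed.

Lemma measurable_power_density_sub a c :
  measurable_fun setT (fun x : measurableTypeR R => g a (c - x)).
Proof.
apply: (measurableT_comp (measurable_power_density a)).
exact: measurable_funB.
Qed.

(** The substitution x = c u: the two kernels are homogeneous of degrees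
    [a - 1] and [b - 1], and dx contributes one more factor [c]. *)
Lemma convolution_power_density a b c : 0 < c ->
  (\int[mu]_x (g a x * g b (c - x))%:E = (c `^ (a + b - 1))%:E * ebeta a b)%E.
Proof.
move=> c0; rewrite (ge0_integral_affine 0 c0); last 2 first.
- apply/measurable_EFinP/measurable_funM; first exact: measurable_power_density.
  exact: measurable_power_density_sub.
- by move=> x; rewrite lee_fin mulr_ge0 ?power_density_ge0.
under eq_integral => x _.
  rewrite addr0 (_ : c - c * x = c * (1 - x)); last by ring.
  rewrite !power_densityM// mulrACA EFinM; over.
rewrite ge0_integralZl//; last 3 first.
- apply/measurable_EFinP/measurable_funM; first exact: measurable_power_density.
  exact: measurable_power_density_sub.
- by move=> x _; rewrite lee_fin mulr_ge0 ?power_density_ge0.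
- by rewrite lee_fin mulr_ge0 ?powR_ge0.
rewrite muleA -EFinM; congr (_%:E * _)%E.
have cn0 : c != 0 by rewrite gt_eqF.
rewrite -{1}(powRr1 (ltW c0)) -!powRD ?cn0 ?implybT//.
by congr powR; ring.
Qed.

Lemma convolution_power_density_lt0 a b c : c < 0 ->
  (\int[mu]_x (g a x * g b (c - x))%:E = 0)%E.
Proof.
move=> c0; apply: integral0_eq => x _; congr EFin.
have [x0|x0] := ltP x 0; first by rewrite power_density_lt0 ?mul0r.
by rewrite [g b _]power_density_lt0 ?mulr0// subr_lt0 (lt_le_trans c0).
Qed.

Lemma measurable_gamma_integrand a :
  measurable_fun setT (fun x : measurableTypeR R => g a x * expR (- x)).
Proof.
apply: measurable_funM; first exact: measurable_power_density.
by apply: measurableT_comp => //; exact: measurableT_comp.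
Qed.

(** In the double integral for the product, substitute z = x + y for y and
    integrate over x first: the inner integral is the convolution of two power
    kernels. *)
Lemma egammaM a b :
  (egamma a * egamma b = ebeta a b * egamma (a + b))%E.
Proof.
pose f (x z : R) := (g a x * g b (z - x) * expR (- z))%:E.
have f0 x z : (0 <= f x z)%E.
  by rewrite lee_fin !mulr_ge0 ?power_density_ge0 ?expR_ge0.
have mf : measurable_fun setT
    (fun w : measurableTypeR R * measurableTypeR R => f w.1 w.2).
  apply/measurable_EFinP/measurable_funM; first apply: measurable_funM.
  - exact: (measurableT_comp (measurable_power_density a) measurable_fst).
  - pose w21 (w : measurableTypeR R * measurableTypeR R) : measurableTypeR R := w.2 - w.1.
    have mw21 : measurable_fun setT w21 by exact: measurable_funB.
    exact: (measurableT_comp (measurable_power_density b) mw21).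
  - pose w2 (w : measurableTypeR R * measurableTypeR R) : measurableTypeR R := - w.2.
    have mw2 : measurable_fun setT w2 by apply: measurable_funN; exact: measurable_snd.
    exact: (measurableT_comp (@measurable_expR R) mw2).
transitivity (\int[mu]_x \int[mu]_z f x z)%E.
  rewrite {1}/egamma -ge0_integralZr//; last 3 first.
  - apply/measurable_EFinP; exact: measurable_gamma_integrand.
  - by move=> x _; rewrite lee_fin mulr_ge0 ?power_density_ge0 ?expR_ge0.
  - exact: egamma_ge0.
  apply: eq_integral => x _.
  rewrite /egamma (ge0_integral_affine (- x) ltr01); last 2 first.
  - apply/measurable_EFinP; exact: measurable_gamma_integrand.
  - by move=> y; rewrite lee_fin mulr_ge0 ?power_density_ge0 ?expR_ge0.
  rewrite mul1e -ge0_integralZl//; last 3 first.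
  - apply/measurable_EFinP.
    apply: (measurableT_comp (measurable_gamma_integrand b)).
    by apply: measurable_funD => //; exact: measurable_funM.
  - by move=> y _; rewrite lee_fin mulr_ge0 ?power_density_ge0 ?expR_ge0.
  - by rewrite lee_fin mulr_ge0 ?power_density_ge0 ?expR_ge0.
  apply: eq_integral => z _; rewrite -EFinM /f mul1r; congr EFin.
  rewrite mulrACA -expRD; congr (_ * expR _); ring.
rewrite (@fubini_tonelli _ _ _ _ _ mu mu (fun w => f w.1 w.2))//=.
rewrite /egamma -ge0_integralZl//; last 3 first.
- apply/measurable_EFinP; exact: measurable_gamma_integrand.
- by move=> y _; rewrite lee_fin mulr_ge0 ?power_density_ge0 ?expR_ge0.
- exact: ebeta_ge0.
apply: (@eq_integral_off_point 0).
- exact: (measurable_fun_fubini_tonelli_G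
    (fun w : measurableTypeR R * measurableTypeR R => f w.1 w.2)).
- apply: emeasurable_funM => //.
  apply/measurable_EFinP; exact: measurable_gamma_integrand.
move=> z z0; rewrite /f.
under eq_integral do rewrite EFinM.
rewrite ge0_integralZr//; last 2 first.
- apply/measurable_EFinP/measurable_funM; first exact: measurable_power_density.
  exact: measurable_power_density_sub.
- by move=> y _; rewrite lee_fin mulr_ge0 ?power_density_ge0.
have [zlt|zgt|zE] := ltgtP z 0; last by rewrite zE eqxx in z0.
  by rewrite convolution_power_density_lt0// power_density_lt0// mul0r mule0 mul0e.
rewrite convolution_power_density// /g (ltW zgt) EFinM.
by rewrite [in LHS](muleC (_ `^ _)%:E) muleA.
Qed.

End beta_gamma.

Section gamma_function.
Variable R : realType.
Local Notation mu := (@lebesgue_measure R).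
Local Notation g := (@power_density R).
Implicit Types a b c x y : R.

Lemma derive_powR_div a x : 0 < a -> 0 < x ->
  is_derive x 1 (fun y => y `^ a / a) (x `^ (a - 1)).
Proof.
move=> a0 x0; rewrite (_ : (fun y => _) = a^-1 \*: (fun y : R => y `^ a)); last first.
  by apply/funext => y; rewrite mulrC.
rewrite (_ : x `^ _ = a^-1 *: (a * x `^ (a - 1))).
  by apply: is_deriveZ; exact: is_derive1_powR.
by rewrite /GRing.scale/= mulrA mulVf ?mul1r// gt_eqF.
Qed.

Lemma integral_powR_itvcc a (e : R) : 0 < a -> 0 < e < 1 ->
  (\int[mu]_(x in `[e, 1%R]) (x `^ (a - 1))%:E = (a^-1 - e `^ a / a)%:E)%E.
Proof.
move=> a0 /andP[e0 e1].
have dF x : 0 < x -> is_derive x 1 (fun y => y `^ a / a) (x `^ (a - 1)).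
  exact: derive_powR_div.
have cp b x : 0 < x -> {for x, continuous (fun y => y `^ b)}.
  move=> x0; apply: differentiable_continuous; apply/derivable1_diffP.
  by apply: derivable_powR; rewrite in_itv/= x0.
have cF x : 0 < x -> {for x, continuous (fun y => y `^ a / a)}.
  move=> x0; apply: differentiable_continuous; apply/derivable1_diffP.
  by have [] := dF _ x0.
rewrite (@continuous_FTC2 _ _ (fun y => y `^ a / a))//.
- by rewrite powR1 div1r.
- apply: continuous_in_subspaceT => x; rewrite inE/= in_itv/= => /andP[ex _].
  by apply: cp; exact: lt_le_trans ex.
- split.
  + move=> x; rewrite in_itv/= => /andP[ex _].
    by have [] := dF _ (lt_trans e0 ex).
  + by apply: cvg_at_right_filter; exact: cF.
  + by apply: cvg_at_left_filter; exact: cF.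
- move=> x; rewrite in_itv/= => /andP[ex _].
  have := dF _ (lt_trans e0 ex).
  by move=> d; rewrite derive1E; exact: derive_val.
Qed.

(** For [a < 1] the integrand is unbounded at 0, so the fundamental theorem of
    calculus is applied on [[e, 1]] and [e] is sent to 0. *)
Lemma integral_powR_itvoc a : 0 < a ->
  (\int[mu]_(x in `]0%R, 1%R]) (x `^ (a - 1))%:E = (a^-1)%:E)%E.
Proof.
move=> a0; rewrite itv_open_bnd_bigcup.
pose F n : set (measurableTypeR R) := `[(0 + n.+1%:R^-1 : R), 1]%classic.
have mp : measurable_fun setT (fun x : measurableTypeR R => (x `^ (a - 1))%:E).
  by apply/measurable_EFinP; exact: measurable_powR.
have ndF : nondecreasing_seq F.
  move=> m n mn; rewrite subsetEset; apply: subset_itvr.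
  by rewrite bnd_simp !add0r lef_pV2 ?posrE// ler_nat.
have f0 i x : F i x -> (0 <= (x `^ (a - 1))%:E)%E by rewrite lee_fin powR_ge0.
have /cvg_lim <- // := @ge0_nondecreasing_set_cvg_integral _ (measurableTypeR R)
  R F _ mu ndF (fun i => measurable_itv _) (fun i => measurable_funTS mp) f0.
apply/cvg_lim => //; rewrite -(cvg_shiftS _).
rewrite (_ : (fun n => _) =
    (fun n => (a^-1 - (n.+2%:R^-1) `^ a / a)%:E)); last first.
  apply/funext => n; rewrite /F add0r integral_powR_itvcc//.
  by rewrite invr_gt0 ltr0n/= invf_lt1// ltr1n.
apply: cvg_EFin; first exact: nearW.
rewrite -[X in _ --> X]subr0; apply: cvgB; first exact: cvg_cst.
rewrite -[X in _ --> X](mul0r a^-1); apply: cvgMl.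
have /cvg_at_rightP := powR_cvg0 a0; apply; split.
  by move=> n; rewrite invr_gt0.
have := @cvg_harmonic R; rewrite -(cvg_shiftS _); exact.
Qed.

Lemma ebeta1 a : 0 < a -> ebeta a 1 = (a^-1)%:E.
Proof.
move=> a0; rewrite -integral_powR_itvoc// [RHS]integral_mkcond.
apply: (@eq_integral_off_point _ 0).
- apply/measurable_EFinP/measurable_funM; first exact: measurable_power_density.
  exact: measurable_power_density_sub.
- apply/(measurable_restrictT _ _).1 => //.
  by apply/measurable_EFinP; apply: measurable_funTS; exact: measurable_powR.
move=> x x0; rewrite patchE mem_setE in_itv/= /power_density subrr powRr0 subr_ge0.
have -> : (0 <= x) = (0 < x) by rewrite lt_def x0.
by case: ltP => _; case: leP => _; rewrite ?mulr1 ?mulr0 ?mul0r.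
Qed.

Lemma egamma1 : egamma (1 : R) = 1%E.
Proof.
rewrite -(@integral_exponential_pdf R 1 ltr01); apply: eq_integral => x _.
rewrite /power_density subrr powRr0; congr EFin.
have [x0|x0] := leP 0 x; last by rewrite lt0_exponential_pdf ?mul0r.
by rewrite exponential_pdfE// mulN1r.
Qed.

(** The case [b = 1] of [egammaM], in which the Beta integral is elementary. *)
Lemma egammaS a : 0 < a -> egamma (a + 1) = (a%:E * egamma a)%E.
Proof.
move=> a0; have := egammaM a 1; rewrite egamma1 mule1 ebeta1// => ->.
by rewrite muleA -EFinM mulfV ?gt_eqF// mul1e.
Qed.

Lemma egamma_nat n : (egamma (n.+1%:R : R) < +oo)%E.
Proof.
elim: n => [|n ih]; first by rewrite egamma1 ltry.
by rewrite -[n.+2]addn1 natrD egammaS// lte_mul_pinfty// lee_fin.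
Qed.

(** Convergence at infinity is inherited from the integer arguments: on the
    half-line, x^a is at most 1 + x^n for [n] above [a]. The functional
    equation then brings the result from [a + 1] down to [a], which takes care
    of the singularity at 0. *)
Lemma egamma_lty a : 0 < a -> (egamma a < +oo)%E.
Proof.
move=> a0; suff : (egamma (a + 1) < +oo)%E.
  rewrite egammaS//; case: (egamma a) => [r| |]; rewrite ?ltry//.
  by rewrite gt0_muley// lte_fin.
pose n := (Num.truncn a).+1.
have an : a <= n%:R by apply/ltW/truncnS_gt.
apply: (@le_lt_trans _ _ (egamma (1 : R) + egamma (n.+1%:R : R))%E); last first.
  by apply: lte_add_pinfty; [rewrite egamma1 ltry|exact: egamma_nat].
have ge0 b x : (0 <= (g b x * expR (- x))%:E)%E.
  by rewrite lee_fin mulr_ge0 ?power_density_ge0 ?expR_ge0.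
have mg b : measurable_fun setT
    (fun x : measurableTypeR R => (g b x * expR (- x))%:E).
  by apply/measurable_EFinP; exact: measurable_gamma_integrand.
rewrite /egamma -ge0_integralD//; apply: ge0_le_integral => //.
  exact: emeasurable_funD.
move=> x _; rewrite -EFinD -mulrDl lee_fin ler_wpM2r ?expR_ge0//.
rewrite /power_density; case: ifPn => // x0.
rewrite subrr powRr0 addrK -natr1 addrK.
have [x1|x1] := leP 1 x.
  by rewrite (le_trans (ler_powR x1 an))// lerDr.
apply: (@le_trans _ _ 1); last by rewrite lerDl powR_ge0.
have := @ge0_ler_powR R a (ltW a0) x 1.
by rewrite powR1 !nnegrE; apply => //; exact: ltW.
Qed.

(** On [[1, 2]] the integrand is at least e^-2 / 2. *)
Lemma egamma_gt0 a : 0 < a -> (0 < egamma a)%E.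
Proof.
move=> a0; pose c : R := 2^-1 * expR (- 2).
have mg : measurable_fun setT
    (fun x : measurableTypeR R => (g a x * expR (- x))%:E).
  by apply/measurable_EFinP; exact: measurable_gamma_integrand.
have ge0 x : (0 <= (g a x * expR (- x))%:E)%E.
  by rewrite lee_fin mulr_ge0 ?power_density_ge0 ?expR_ge0.
apply: (@lt_le_trans _ _ (\int[mu]_(x in `[1%R, 2%R]) c%:E)%E).
  rewrite integral_cst//= lebesgue_measure_itv/= lte_fin ltr1n/= -EFinD -EFinM.
  by rewrite lte_fin !mulr_gt0 ?expR_gt0// subr_gt0 ltr1n.
apply: (@le_trans _ _
    (\int[mu]_(x in `[1%R, 2%R]) (g a x * expR (- x))%:E)%E); last first.
  by apply: ge0_subset_integral => // x _; exact: ge0.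
apply: ge0_le_integral => //.
- by move=> x _; rewrite lee_fin mulr_ge0 ?expR_ge0.
- exact: measurable_funTS.
move=> x /=; rewrite in_itv/= => /andP[x1 x2]; rewrite lee_fin.
have x0 : 0 < x by exact: lt_le_trans x1.
apply: ler_pM; rewrite ?expR_ge0 ?ler_expR ?lerN2//.
rewrite /power_density (ltW x0); apply: (@le_trans _ _ (x `^ (-1))).
  by rewrite powR_inv1 ?(ltW x0)// lef_pV2 ?posrE.
by apply: ler_powR => //; rewrite lerBrDr addNr ltW.
Qed.

Lemma GammaE a : Gamma a = fine (egamma a).
Proof.
rewrite /Gamma /Rintegral integral_mkcond; congr fine.
apply: (@eq_integral_off_point _ 0).
- apply/(measurable_restrictT _ _).1 => //.
  apply/measurable_EFinP/measurable_funTS/measurable_funM.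
    exact: measurable_powR.
  by apply: measurableT_comp => //; exact: measurableT_comp.
- by apply/measurable_EFinP; exact: measurable_gamma_integrand.
move=> x x0; rewrite patchE mem_setE in_itv/= andbT /power_density.
have -> : (0 <= x) = (0 < x) by rewrite lt_def x0.
by case: ifP => // _; rewrite mul0r.
Qed.

Lemma EFin_Gamma a : 0 < a -> (Gamma a)%:E = egamma a.
Proof.
move=> a0; rewrite GammaE fineK// ge0_fin_numE ?egamma_lty//.
exact: egamma_ge0.
Qed.

Lemma Gamma_gt0 a : 0 < a -> 0 < Gamma a.
Proof. by move=> a0; rewrite -lte_fin EFin_Gamma// egamma_gt0. Qed.

Lemma GammaD1 a : 0 < a -> Gamma (a + 1) = a * Gamma a.
Proof.
move=> a0; have a10 : 0 < a + 1 by rewrite addr_gt0.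
by apply: EFin_inj; rewrite EFinM (EFin_Gamma a10) (EFin_Gamma a0) egammaS.
Qed.

Lemma ebetaE a b : 0 < a -> 0 < b ->
  ebeta a b = (Gamma a * Gamma b / Gamma (a + b))%:E.
Proof.
move=> a0 b0; have ab0 : 0 < a + b by rewrite addr_gt0.
have := egammaM a b; rewrite -!EFin_Gamma// -EFinM => H.
rewrite EFinM H -muleA -EFinM mulfV ?mule1//.
by rewrite gt_eqF// Gamma_gt0.
Qed.

End gamma_function.

(** * Dirichlet's integral *)

Section dirichlet_integral.
Variable R : realType.
Local Notation mu := (@lebesgue_measure R).
Local Notation g := (@power_density R).

(** The last barycentric coordinate is [c] minus the others; letting the total
    mass [c] vary is what allows an induction on the dimension. *)
Definition simplex_weight n (b : 'I_n -> R) (l c : R) (t : n.-tuple R) : R :=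
  (\prod_(i < n) g (b i) (tnth t i)) * g l (c - \sum_(i < n) tnth t i).

Lemma simplex_weight_ge0 n (b : 'I_n -> R) l c t : 0 <= simplex_weight b l c t.
Proof.
by rewrite mulr_ge0 ?power_density_ge0// prodr_ge0// => i _; exact: power_density_ge0.
Qed.

Lemma measurable_simplex_weight n (b : 'I_n -> R) l c :
  measurable_fun setT (simplex_weight b l c).
Proof.
apply: measurable_funM.
  apply: measurable_prod => i _.
  exact: (measurableT_comp (measurable_power_density _) (measurable_tnth i)).
pose h (t : n.-tuple R) : measurableTypeR R := c - \sum_(i < n) tnth t i.
have mh : measurable_fun setT h.
  apply: measurable_funB => //; apply: measurable_sum => i.
  exact: measurable_tnth.
exact: (measurableT_comp (measurable_power_density l) mh).
Qed.

Lemma simplex_weight_cons n (b : 'I_n.+1 -> R) l c x (t : n.-tuple R) :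
  simplex_weight b l c (tuple_cons (x, t)) =
  g (b ord0) x * simplex_weight (fun i => b (lift ord0 i)) l (c - x) t.
Proof.
rewrite /simplex_weight !big_ord_recl tnth0 -mulrA opprD addrA.
congr (_ * (_ * g _ (_ - _))).
  by apply: eq_bigr => i _; rewrite tnthS.
by apply: eq_bigr => i _; rewrite tnthS.
Qed.

Lemma integral_lebesgue_tupleS n (f : n.+1.-tuple R -> \bar R) :
  measurable_fun setT f -> (forall t, 0 <= f t)%E ->
  (\int[lebesgue_tuple R n.+1]_t f t =
   \int[mu]_x \int[lebesgue_tuple R n]_t f (tuple_cons (x, t)))%E.
Proof.
move=> mf f0.
rewrite /= /lebesgue_tuple_step ge0_integral_pushforward//; last first.
  exact: measurable_tuple_cons.
rewrite preimage_setT fubini_tonelli1//=.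
exact: (measurableT_comp mf (@measurable_tuple_cons R n)).
Qed.

(** Dirichlet's integral. Integrating out all coordinates but the first gives a
    power kernel in [c - x] by induction, and the remaining integral is a
    convolution of two power kernels. At [c = 0] the simplex degenerates and the
    right-hand side depends on the convention for the kernel at 0; in the
    induction this value is met at the single point [x = c] only. *)
Lemma integral_simplex_weight n (b : 'I_n -> R) l c :
  (forall i, 0 < b i) -> 0 < l -> c != 0 ->
  (\int[lebesgue_tuple R n]_t (simplex_weight b l c t)%:E =
   ((\prod_(i < n) Gamma (b i)) * Gamma l / Gamma (\sum_(i < n) b i + l) *
    g (\sum_(i < n) b i + l) c)%:E)%E.
Proof.
move=> + l0; elim: n b c => [|n ih] b c b0 c0.
  rewrite /= integral_dirac//; last first.
    by apply/measurable_EFinP; exact: measurable_simplex_weight.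
  rewrite diracT mul1e /simplex_weight !big_ord0 subr0 add0r !mul1r.
  by rewrite divff ?mul1r// gt_eqF// Gamma_gt0.
pose b' i := b (lift ord0 i); pose s := \sum_(i < n) b' i + l.
have s0 : 0 < s by rewrite ltr_wpDl// sumr_ge0// => i _; rewrite ltW// b0.
have mw m (b1 : 'I_m -> R) l1 c1 :
    measurable_fun setT (EFin \o simplex_weight b1 l1 c1).
  by apply/measurable_EFinP; exact: measurable_simplex_weight.
rewrite integral_lebesgue_tupleS; last 2 first.
- exact: mw.
- by move=> t; rewrite lee_fin simplex_weight_ge0.
pose K := (\prod_(i < n) Gamma (b' i)) * Gamma l / Gamma s.
have K0 : 0 <= K.
  by rewrite divr_ge0 ?mulr_ge0 ?Gamma_ge0// prodr_ge0// => i _; exact: Gamma_ge0.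
transitivity (\int[mu]_x (K * (g (b ord0) x * g s (c - x)))%:E)%E.
  apply: (@eq_integral_off_point _ c).
  - apply: (measurable_fun_fubini_tonelli_F
      (fun w => (simplex_weight b l c (tuple_cons w))%:E)) => //.
    + exact: (measurableT_comp (mw _ _ _ _) (@measurable_tuple_cons R n)).
    + by move=> w; rewrite lee_fin simplex_weight_ge0.
  - apply/measurable_EFinP/measurable_funM => //; apply: measurable_funM.
      exact: measurable_power_density.
    exact: measurable_power_density_sub.
  move=> x xc.
  under eq_integral do rewrite simplex_weight_cons EFinM.
  rewrite ge0_integralZl//; last 3 first.
  - exact: mw.
  - by move=> t _; rewrite lee_fin simplex_weight_ge0.
  - by rewrite lee_fin power_density_ge0.
  rewrite ih//; last by rewrite subr_eq0 eq_sym.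
  by rewrite -EFinM mulrCA.
under eq_integral do rewrite EFinM.
rewrite ge0_integralZl//; last 2 first.
- apply/measurable_EFinP/measurable_funM; first exact: measurable_power_density.
  exact: measurable_power_density_sub.
- by move=> x _; rewrite lee_fin mulr_ge0 ?power_density_ge0.
have bs : \sum_(i < n.+1) b i + l = b ord0 + s.
  by rewrite big_ord_recl addrA.
rewrite bs; have [clt|cgt|cE] := ltgtP c 0; last by rewrite cE eqxx in c0.
  rewrite convolution_power_density_lt0// mule0 (power_density_lt0 _ clt).
  by congr EFin; rewrite [RHS]mulr0.
rewrite convolution_power_density// ebetaE// -!EFinM; congr EFin.
rewrite /power_density (ltW cgt) /K big_ord_recl.
have G0 : Gamma s != 0 by rewrite gt_eqF// Gamma_gt0.
have G1 : Gamma (b ord0 + s) != 0 by rewrite gt_eqF// Gamma_gt0// addr_gt0.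
move: (Gamma s) (Gamma (b ord0 + s)) G0 G1 => Gs Gbs G0 G1.
move: (Gamma (b ord0)) (Gamma l) (\prod_(i < n) _) (c `^ _) => u v w z.
by field; rewrite G0 G1.
Qed.

End dirichlet_integral.

(** * Integration against the image of a measure with density *)

Section density_pushforward.
Local Open Scope ereal_scope.
Context d d' (X : measurableType d) (Y : measurableType d') (R : realType).
Variables (m : {measure set X -> \bar R}) (nu : {measure set Y -> \bar R}).
Variables (phi : X -> Y) (S : set Y) (w : X -> R).
Hypotheses (mphi : measurable_fun setT phi) (mS : measurable S)
  (mw : measurable_fun setT w) (w0 : forall x, (0 <= w x)%R).
Hypothesis nuE : forall A, measurable A ->
  nu A = \int[m]_(x in phi @^-1` (A `&` S)) (w x)%:E.

Import HBNNSimple.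

Let mpre A : measurable A -> measurable (phi @^-1` A).
Proof. by move=> mA; rewrite -[X in measurable X]setTI; exact: mphi. Qed.

(** For indicators this is the hypothesis on [nu]; it extends to simple functions
    by linearity and to nonnegative functions by monotone convergence. *)
Lemma ge0_integral_density_pushforward (F : Y -> \bar R) :
  measurable_fun setT F -> (forall y, 0 <= F y) ->
  \int[nu]_(y in S) F y = \int[m]_(x in phi @^-1` S) (F (phi x) * (w x)%:E).
Proof.
move=> mF F0; pose h := nnsfun_approx measurableT mF.
have mew : measurable_fun setT (EFin \o w) by exact/measurable_EFinP.
have mh n : measurable_fun setT (EFin \o h n) by exact/measurable_EFinP.
have mhp n : measurable_fun setT (fun x => (h n (phi x))%:E).
  exact: (measurableT_comp (mh n) mphi).
have hF y : (h n y)%:E @[n --> \oo] --> F y by exact: cvg_nnsfun_approx.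
have -> : \int[nu]_(y in S) F y = limn (fun n => \int[nu]_(y in S) (h n y)%:E).
  rewrite -monotone_convergence//.
  - by apply: eq_integral => y _; apply/esym/cvg_lim.
  - by move=> n; apply: measurable_funTS; exact: mh.
  - by move=> n y _; rewrite lee_fin.
  - by move=> y _ a b ab; rewrite lee_fin; exact/lefP/nd_nnsfun_approx.
have -> : \int[m]_(x in phi @^-1` S) (F (phi x) * (w x)%:E) =
    limn (fun n => \int[m]_(x in phi @^-1` S) ((h n (phi x))%:E * (w x)%:E)).
  rewrite -monotone_convergence//.
  - apply: eq_integral => x _; apply/esym/cvg_lim => //.
    by apply: cvgeZr => //; exact: hF.
  - exact: mpre.
  - by move=> n; apply: measurable_funTS; exact: emeasurable_funM.
  - by move=> n x _; rewrite mule_ge0 ?lee_fin.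
  - move=> x _ a b ab; rewrite lee_wpmul2r ?lee_fin//.
    exact/lefP/nd_nnsfun_approx.
congr (limn _); apply/funext => n.
pose A r := h n @^-1` [set r].
have mA r : measurable (A r) by exact: measurable_funPTI.
transitivity (\sum_(r \in range (h n)) r%:E * nu (A r `&` S)).
  under eq_integral do rewrite fimfunE -fsumEFin//.
  rewrite ge0_integral_fsum//; last 2 first.
  - by move=> r; apply: measurable_funTS; exact/measurable_EFinP/measurable_funM.
  - by move=> r y _; rewrite nnfun_muleindic_ge0.
  apply: eq_fsbigr => r _; rewrite integralZl_indic_nnsfun// integral_indic//.
transitivity (\sum_(r \in range (h n))
    \int[m]_(x in phi @^-1` S) (r * \1_(A r) (phi x) * w x)%:E); last first.
  rewrite -ge0_integral_fsum//.
  - apply: eq_integral => x _; rewrite fsumEFin// -EFinM; congr EFin.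
    by rewrite fimfunE mulr_fsuml.
  - exact: mpre.
  - move=> r; apply: measurable_funTS; apply/measurable_EFinP/measurable_funM => //.
    apply: measurable_funM => //.
    exact: (measurableT_comp (measurable_indic (mA r)) mphi).
  - move=> r x _; rewrite EFinM mule_ge0 ?lee_fin//.
    by have := nnfun_muleindic_ge0 (h n) r (phi x); rewrite lee_fin.
apply: eq_fsbigr => r /[!inE] -[y _ yr].
have r0 : (0 <= r)%R by rewrite -yr.
rewrite nuE; last exact: measurableI.
under [RHS]eq_integral do rewrite -mulrA EFinM.
rewrite ge0_integralZl//; last 3 first.
- exact: mpre.
- apply: measurable_funTS; apply/measurable_EFinP/measurable_funM => //.
  exact: (measurableT_comp (measurable_indic (mA r)) mphi).
- by move=> x _; rewrite lee_fin mulr_ge0.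
congr (_ * _); rewrite -setIA setIid preimage_setI setIC integral_mkcondr.
apply: eq_integral => x _; rewrite patchE /= indicE.
rewrite [x \in _](_ : _ = (phi x \in A r)); last by apply/idP/idP => /[!inE].
by case: ifP => _; rewrite ?mul1r ?mul0r.
Qed.

(** Multiplication by the nonnegative density commutes with taking positive and
    negative parts, which reduces this to the nonnegative case. *)
Lemma integral_density_pushforward (F : Y -> \bar R) :
  measurable_fun setT F ->
  \int[nu]_(y in S) F y = \int[m]_(x in phi @^-1` S) (F (phi x) * (w x)%:E).
Proof.
move=> mF; rewrite integralE [RHS]integralE; congr (_ - _).
- rewrite ge0_integral_density_pushforward//; last exact: measurable_funepos.
  by apply: eq_integral => x _; rewrite !funeposE maxe_pMl ?mul0e ?lee_fin.
- rewrite ge0_integral_density_pushforward//; last exact: measurable_funeneg.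
  by apply: eq_integral => x _; rewrite !funenegE maxe_pMl ?mul0e ?mulNe ?lee_fin.
Qed.

End density_pushforward.

(** * Moments of the Dirichlet distribution *)

Lemma prod_change_one (R : comPzRingType) (I : finType) (F G : I -> R) (i : I) c :
  G i = c * F i -> (forall j, j != i -> G j = F j) ->
  \prod_j G j = c * \prod_j F j.
Proof.
move=> Gi GF; rewrite (bigD1 i)//= [in RHS](bigD1 i)//= Gi -mulrA.
by congr (_ * (_ * _)); exact: eq_bigr.
Qed.

Section dirichlet_moments.
Variables (R : realType) (k : nat).
Implicit Types (alpha s y : k.-tuple R).

Definition add_ball_tuple alpha i : k.-tuple R := mktuple (add_ball (tnth alpha) i).

Lemma tnth_add_ball alpha i : tnth (add_ball_tuple alpha i) =1 add_ball (tnth alpha) i.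
Proof. by move=> j; rewrite tnth_mktuple. Qed.

Lemma add_ball_gt0 alpha i :
  (forall j, 0 < tnth alpha j) -> forall j, 0 < tnth (add_ball_tuple alpha i) j.
Proof. by move=> a0 j; rewrite tnth_add_ball ltr_pwDl. Qed.

Lemma sum_add_ball alpha i :
  \sum_j tnth (add_ball_tuple alpha i) j = \sum_j tnth alpha j + 1.
Proof.
under eq_bigr do rewrite tnth_add_ball /add_ball.
rewrite big_split/=; congr (_ + _).
rewrite (bigD1 i)//= eqxx big1 ?addr0// => j /negbTE -> //.
Qed.

(** The functional equation of Gamma, at [alpha_i] and at the sum of the
    [alpha_j], absorbs the factor [y_i]: size-biasing a Dirichlet distribution
    adds a ball to the urn. *)
Lemma dirichlet_density_add_ball alpha i y :
  (forall j, 0 < tnth alpha j) -> 0 <= tnth y i ->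
  tnth y i * dirichlet_density alpha y =
  tnth alpha i / (\sum_j tnth alpha j) *
  dirichlet_density (add_ball_tuple alpha i) y.
Proof.
move=> a0 y0; rewrite /dirichlet_density sum_add_ball.
have s0 : 0 < \sum_j tnth alpha j.
  by rewrite (bigD1 i)//= ltr_wpDr// sumr_ge0// => j _; rewrite ltW.
have other j : j != i -> tnth (add_ball_tuple alpha i) j = tnth alpha j.
  by move=> /negbTE ji; rewrite tnth_add_ball /add_ball ji addr0.
have chosen : tnth (add_ball_tuple alpha i) i = tnth alpha i + 1.
  by rewrite tnth_add_ball /add_ball eqxx.
have GE : \prod_j Gamma (tnth (add_ball_tuple alpha i) j) =
    tnth alpha i * \prod_j Gamma (tnth alpha j).
  by apply: (prod_change_one (i := i)) => [|j /other ->//]; rewrite chosen GammaD1.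
have yE : \prod_j tnth y j `^ (tnth (add_ball_tuple alpha i) j - 1) =
    tnth y i * \prod_j tnth y j `^ (tnth alpha j - 1).
  apply: (prod_change_one (i := i)) => [|j /other ->//].
  by rewrite chosen addrK mulr_powRB1.
have P0 : \prod_j Gamma (tnth alpha j) != 0.
  by rewrite gt_eqF// prodr_gt0// => j _; exact: Gamma_gt0.
rewrite [X in _ = _ * (_ / X * _)]GE [X in _ = _ * (_ * X)]yE GammaD1//.
move: P0 (lt0r_neq0 (a0 i)) (lt0r_neq0 s0).
move: (\prod_j _) (\prod_j _) (tnth alpha i) (\sum_j _) (Gamma _) (tnth y i)
  => P Q ai sm Gs yi P0 ai0 sm0.
by field; rewrite P0 ai0 sm0.
Qed.

End dirichlet_moments.

Section dirichlet_moment_recurrence.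
Variables (R : realType) (n : nat).
(* In dimension 0 the Dirichlet distribution is not given by a density. *)
Hypothesis n0 : n != 0%N.
Local Notation k := n.+1.
Local Notation lambda := (@lebesgue_tuple R n).
Implicit Types (alpha s y : k.-tuple R) (t : n.-tuple R).
Local Notation chart := (@simplex_chart R k).
Local Notation D := (chart @^-1` @simplex R k).

Let mD : measurable D.
Proof.
rewrite -[X in measurable X]setTI.
by apply: measurable_simplex_chart => //; exact: measurable_simplex.
Qed.

Lemma simplex_chart_widen t (i : 'I_n) :
  tnth (chart t) (widen_ord (leqnSn n) i) = tnth t i.
Proof. by rewrite tnth_mktuple /= ltn_ord (tnth_nth 0). Qed.

Lemma simplex_chart_max t : tnth (chart t) ord_max = 1 - \sum_(j < n) tnth t j.
Proof. by rewrite tnth_mktuple /= ltnn. Qed.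

Lemma simplex_chartP t :
  D t <-> (forall i, 0 <= tnth t i) /\ 0 <= 1 - \sum_(j < n) tnth t j.
Proof.
split => [[t0 _]|[t0 s0]].
  split => [i|]; first by rewrite -simplex_chart_widen.
  by rewrite -simplex_chart_max.
split.
  move=> i; have [j ->|->] := unliftP ord_max i.
    by rewrite -[lift _ _](_ : widen_ord (leqnSn n) j = _) ?simplex_chart_widen//;
      apply/val_inj; rewrite /= /bump leqNgt ltn_ord.
  by rewrite simplex_chart_max.
rewrite big_ord_recr/= simplex_chart_max.
under eq_bigr do rewrite simplex_chart_widen.
by rewrite addrC subrK.
Qed.

(** Off the closed simplex one of the power kernels vanishes. *)
Lemma dirichlet_density_chart alpha t :
  dirichlet_density alpha (chart t) * \1_D t =
  Gamma (\sum_(i < k) tnth alpha i) / \prod_(i < k) Gamma (tnth alpha i) *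
  simplex_weight (fun i => tnth alpha (widen_ord (leqnSn n) i))
    (tnth alpha ord_max) 1 t.
Proof.
rewrite indicE /dirichlet_density -mulrA; congr (_ * _).
have [|/negP] := boolP (t \in D).
  rewrite inE => /simplex_chartP[t0 s0]; rewrite mulr1 big_ord_recr/=.
  rewrite /simplex_weight /power_density s0 simplex_chart_max; congr (_ * _).
  by apply: eq_bigr => i _; rewrite simplex_chart_widen t0.
rewrite inE => nD; rewrite mulr0; apply/esym/eqP; rewrite mulf_eq0.
have [s0|s0] := leP 0 (1 - \sum_(j < n) tnth t j); last first.
  by rewrite [X in _ || (X == 0)]power_density_lt0// eqxx orbT.
apply/orP; left.
have [i ti] : exists i, tnth t i < 0.
  apply: contrapT => /forallNP t0; apply: nD; apply/simplex_chartP; split => // i.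
  by rewrite leNgt; apply/negP; exact: t0.
by apply/eqP; rewrite (bigD1 i)//= power_density_lt0 ?mul0r.
Qed.

Let mdens alpha : measurable_fun setT (fun t => dirichlet_density alpha (chart t)).
Proof.
exact: (measurableT_comp (measurable_dirichlet_density alpha)
  (@measurable_simplex_chart R k)).
Qed.

(** Dirichlet's integral at total mass 1. *)
Lemma integral_dirichlet_density alpha : (forall i, 0 < tnth alpha i) ->
  (\int[lambda]_(t in D) (dirichlet_density alpha (chart t))%:E = 1)%E.
Proof.
move=> a0; rewrite integral_mkcond.
rewrite (eq_integral (fun t => (dirichlet_density alpha (chart t) * \1_D t)%:E));
  last first.
  move=> t _; rewrite patchE indicE.
  by case: ifP => _; rewrite ?mulr1 ?mulr0.
under eq_integral do rewrite dirichlet_density_chart EFinM.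
rewrite ge0_integralZl//; last 3 first.
- by apply/measurable_EFinP; exact: measurable_simplex_weight.
- by move=> t _; rewrite lee_fin simplex_weight_ge0.
- by rewrite lee_fin divr_ge0 ?Gamma_ge0// prodr_ge0// => i _; exact: Gamma_ge0.
rewrite integral_simplex_weight ?oner_neq0// -EFinM; congr EFin.
rewrite /power_density ler01 powR1 mulr1.
have -> : \sum_(i < n) tnth alpha (widen_ord (leqnSn n) i) + tnth alpha ord_max =
    \sum_(i < k) tnth alpha i by rewrite big_ord_recr.
have -> : \prod_(i < n) Gamma (tnth alpha (widen_ord (leqnSn n) i)) *
    Gamma (tnth alpha ord_max) = \prod_(i < k) Gamma (tnth alpha i).
  by rewrite [RHS]big_ord_recr.
have P0 : \prod_(j < k) Gamma (tnth alpha j) != 0.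
  by rewrite gt_eqF// prodr_gt0// => j _; exact: Gamma_gt0.
have S0 : Gamma (\sum_(i < k) tnth alpha i) != 0.
  by rewrite gt_eqF// Gamma_gt0// big_ord_recl ltr_wpDr// sumr_ge0// => i _; rewrite ltW.
move: P0 S0; move: (\prod_(j < k) _) (Gamma _) => P S P0 S0.
by field; rewrite P0 S0.
Qed.

Lemma measurable_dot_expn s m : measurable_fun setT
  (fun y => (\sum_(i < k) tnth s i * tnth y i) ^+ m).
Proof.
apply: measurable_funX; apply: measurable_sum => i.
by apply: measurable_funM => //; exact: measurable_tnth.
Qed.

Lemma dirichlet_momentE m s alpha :
  dirichlet_moment m s alpha =
  (\int[lambda]_(t in D) ((\sum_(i < k) tnth s i * tnth (chart t) i) ^+ m *
     dirichlet_density alpha (chart t))%:E)%E.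
Proof.
rewrite /dirichlet_moment (@integral_density_pushforward _ _ _ _ _ lambda
  _ chart _ (fun t => dirichlet_density alpha (chart t)))//.
- exact: (@measurable_simplex_chart R k).
- exact: measurable_simplex.
- by move=> t; exact: dirichlet_density_ge0.
- by move=> A mA; rewrite /= /dirichlet (negbTE (_ : n.+1 != 1%N)).
- by apply/measurable_EFinP; exact: measurable_dot_expn.
Qed.

(** On the simplex the coordinates are at most 1, so the power is bounded and
    the density dominates. *)
Lemma integrable_dirichlet_moment m s alpha : (forall i, 0 < tnth alpha i) ->
  lambda.-integrable D (fun t =>
    ((\sum_(i < k) tnth s i * tnth (chart t) i) ^+ m *
     dirichlet_density alpha (chart t))%:E).
Proof.
move=> a0; pose M := (\sum_(i < k) `|tnth s i|) ^+ m.
apply: (@le_integrable _ _ _ _ _ mD _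
  (fun t => M%:E * (dirichlet_density alpha (chart t))%:E)%E).
- apply: measurable_funTS; apply/measurable_EFinP/measurable_funM => //.
  exact: (measurableT_comp (measurable_dot_expn s m) (@measurable_simplex_chart R k)).
- move=> t [t0 t1]; rewrite -EFinM/= lee_fin !normrM ler_wpM2r// normrX.
  rewrite [leRHS]ger0_norm ?exprn_ge0 ?sumr_ge0// lerXn2r ?nnegrE ?sumr_ge0//.
  apply: (le_trans (ler_norm_sum _ _ _)); apply: ler_sum => i _.
  rewrite normrM ler_piMr// ger0_norm// -t1 (bigD1 i)//= lerDl sumr_ge0// => j _.
- apply: integrableZl => //; apply/integrableP; split.
    by apply: measurable_funTS; apply/measurable_EFinP.
  under eq_integral do rewrite gee0_abs ?lee_fin ?dirichlet_density_ge0//.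
  by rewrite integral_dirichlet_density// ltry.
Qed.

(** Expand one factor of the power and absorb each coordinate into the density. *)
Lemma dirichlet_momentS_gt1 m s alpha : (forall i, 0 < tnth alpha i) ->
  dirichlet_moment m.+1 s alpha =
  (\sum_(i < k) (tnth s i * (tnth alpha i / \sum_(j < k) tnth alpha j))%:E *
     dirichlet_moment m s (add_ball_tuple alpha i))%E.
Proof.
move=> a0; rewrite dirichlet_momentE.
pose F i t := ((\sum_(i < k) tnth s i * tnth (chart t) i) ^+ m *
     dirichlet_density (add_ball_tuple alpha i) (chart t))%:E.
transitivity (\int[lambda]_(t in D)
  \sum_(i < k) (tnth s i * (tnth alpha i / \sum_(j < k) tnth alpha j))%:E * F i t)%E.
  apply: eq_integral => t /[!inE] -[t0 _].
  rewrite sumEFin; congr EFin; rewrite exprS -mulrA mulr_suml.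
  apply: eq_bigr => i _; have := dirichlet_density_add_ball a0 (t0 i).
  move: (_ ^+ m) (dirichlet_density _ _) (dirichlet_density _ _) (_ / _)
    => S d1 d2 c yd.
  by rewrite -mulrA [in LHS](mulrCA _ S) yd !mulrA -(mulrA _ S) (mulrC S) mulrA.
rewrite integral_sum//; last first.
  by move=> i; apply: integrableZl => //; apply/integrable_dirichlet_moment/add_ball_gt0.
apply: eq_bigr => i _; rewrite integralZl//.
  by rewrite dirichlet_momentE.
by apply/integrable_dirichlet_moment/add_ball_gt0.
Qed.

End dirichlet_moment_recurrence.

Section dirichlet_moment_urn.
Variable R : realType.

Lemma rising0 (a : R) : 0 < a -> rising a 0 = 1.
Proof. by move=> a0; rewrite /rising addr0 divff// gt_eqF// Gamma_gt0. Qed.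

Lemma risingS (a : R) m : 0 < a -> rising a m.+1 = a * rising (a + 1) m.
Proof.
move=> a0; rewrite /rising GammaD1// -natr1 (addrC m%:R) addrA.
have G0 : Gamma a != 0 by rewrite gt_eqF// Gamma_gt0.
have := lt0r_neq0 a0; move: (Gamma (_ + _)) (Gamma a) G0 => u v v0 an0.
by field; rewrite v0 an0.
Qed.

Lemma rising_gt0 (a : R) m : 0 < a -> 0 < rising a m.
Proof. by move=> a0; rewrite divr_gt0// Gamma_gt0// ltr_wpDr. Qed.

(** For [k = 1] the simplex is a single point. *)
Lemma dirichlet_moment_vertex m (s alpha : 1.-tuple R) :
  dirichlet_moment m s alpha = (tnth s ord0 ^+ m)%:E.
Proof.
rewrite /dirichlet_moment (eq_measure_integral (\d_([tuple 1 | _ < 1] : 1.-tuple R)));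
  last by move=> A mA _; rewrite /= /dirichlet.
rewrite integral_dirac; last 2 first.
- exact: measurable_simplex.
- by apply/measurable_EFinP/measurable_funTS; exact: measurable_dot_expn.
rewrite diracE mem_set; first by rewrite mul1e big_ord1 tnth_mktuple mulr1.
by split => [i|]; rewrite ?big_ord1 tnth_mktuple.
Qed.

Lemma dirichlet_moment_degree0 k (s alpha : k.-tuple R) :
  (0 < k)%N -> (forall i, 0 < tnth alpha i) -> dirichlet_moment 0 s alpha = 1%E.
Proof.
case: k s alpha => // -[|n] s alpha _ a0; first by rewrite dirichlet_moment_vertex.
rewrite dirichlet_momentE// -[RHS](integral_dirichlet_density a0)//.
by apply: eq_integral => t _; rewrite mul1r.
Qed.

Lemma dirichlet_momentS k m (s alpha : k.-tuple R) :
  (0 < k)%N -> (forall i, 0 < tnth alpha i) ->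
  dirichlet_moment m.+1 s alpha =
  (\sum_(i < k) (tnth s i * (tnth alpha i / \sum_(j < k) tnth alpha j))%:E *
     dirichlet_moment m s (add_ball_tuple alpha i))%E.
Proof.
case: k s alpha => // -[|n] s alpha _ a0; last exact: dirichlet_momentS_gt1.
rewrite !big_ord1 !dirichlet_moment_vertex divff ?gt_eqF// mulr1 -EFinM.
by rewrite exprS.
Qed.

Lemma dirichlet_moment_urn k m (s alpha : k.-tuple R) :
  (0 < k)%N -> (forall i, 0 < tnth alpha i) ->
  dirichlet_moment m s alpha =
  (urn (tnth alpha) (nseq m (tnth s)) / rising (\sum_(i < k) tnth alpha i) m)%:E.
Proof.
move=> k0; elim: m alpha => [|m ih] alpha a0.
all: have S0 : 0 < \sum_(i < k) tnth alpha i by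
  rewrite (bigD1 (Ordinal k0))//= ltr_wpDr// sumr_ge0// => i _; rewrite ltW.
  by rewrite dirichlet_moment_degree0//= rising0// divr1.
rewrite dirichlet_momentS// risingS//=.
under eq_bigr => i _.
  rewrite ih; last exact: add_ball_gt0.
  rewrite sum_add_ball.
  have -> : tnth (add_ball_tuple alpha i) = add_ball (tnth alpha) i.
    exact/funext/tnth_add_ball.
  rewrite -EFinM; over.
rewrite sumEFin; congr EFin; rewrite mulr_suml; apply: eq_bigr => i _.
have := lt0r_neq0 S0; have := lt0r_neq0 (rising_gt0 m (ltr_wpDr ler01 S0)).
set S := \sum_(j < k) _; set r := rising (S + 1) m => r0 Sn0.
by field; rewrite r0 Sn0.
Qed.

End dirichlet_moment_urn.

(** * The sum over multi-indices *)

Section multi_index.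
Variables (R : realType) (k : nat).
Implicit Types (a s : 'I_k -> R) (i j : 'I_k).

Lemma multi_index_shift n i (G : ('I_k -> nat) -> R) :
  \sum_(m : {ffun 'I_k -> 'I_n.+2} |
      ((\sum_(j < k) m j)%N == n.+1) && (0 < m i)%N) G (fun j => m j) =
  \sum_(m : {ffun 'I_k -> 'I_n.+1} | (\sum_(j < k) m j)%N == n)
      G (fun j => (m j + (j == i))%N).
Proof.
pose up (m : {ffun 'I_k -> 'I_n.+1}) : {ffun 'I_k -> 'I_n.+2} :=
  [ffun j => inord (m j + (j == i))].
pose down (m : {ffun 'I_k -> 'I_n.+2}) : {ffun 'I_k -> 'I_n.+1} :=
  [ffun j => inord (m j - (j == i))].
have upE m j : up m j = (m j + (j == i))%N :> nat.
  rewrite ffunE inordK// -[n.+2]addn1.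
  exact: (leq_add (ltn_ord (m j)) (leq_b1 _)).
rewrite (reindex_onto up down)/=; last first.
  move=> m /andP[/eqP mn mi]; apply/ffunP => j; apply/val_inj.
  rewrite /= upE ffunE inordK.
    by case: eqVneq => [->|_]; [rewrite subnK|rewrite subn0 addn0].
  case: eqVneq => [->|ji]; first by rewrite ltn_subLR.
  have : (m j + m i <= n.+1)%N.
    rewrite -[X in (_ <= X)%N]mn (bigD1 i)//= (bigD1 j)//=.
    by rewrite addnA (addnC (m j)) leq_addr.
  by apply: leq_trans; rewrite subn0 -addn1 leq_add2l.
apply: eq_big => [m|m _]; last by congr G; apply/funext => j; exact: upE.
rewrite upE eqxx addn1 andbT.
under eq_bigr do rewrite upE.
have one : (\sum_(j < k) (j == i))%N = 1%N.
  by rewrite (bigD1 i)//= eqxx big1 ?addn0// => j /negbTE ->.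
rewrite big_split/= one addn1 eqSS; case: eqP => //= _.
by apply/eqP/ffunP => j; rewrite ffunE upE addnK inord_val.
Qed.

Definition multi_index_term a s (m : 'I_k -> nat) : R :=
  (\prod_i s i ^+ m i) / (\prod_i (m i)`!)%N%:R * \prod_i rising (a i) (m i).

Lemma multi_index_term_add_ball a s m i : (forall j, 0 < a j) ->
  (m i).+1%:R * multi_index_term a s (fun j => (m j + (j == i))%N) =
  a i * s i * multi_index_term (add_ball a i) s m.
Proof.
move=> a0; rewrite /multi_index_term !natr_prod.
have sE : \prod_j s j ^+ (m j + (j == i)) = s i * \prod_j s j ^+ m j.
  apply: (prod_change_one (i := i)) => [|j /negbTE ->]; last by rewrite addn0.
  by rewrite eqxx addn1 exprS.
have fE : \prod_j (m j + (j == i))`!%:R = (m i).+1%:R * \prod_j (m j)`!%:R :> R.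
  apply: (prod_change_one (i := i)) => [|j /negbTE ->]; last by rewrite addn0.
  by rewrite eqxx addn1 factS natrM.
have rE : \prod_j rising (a j) (m j + (j == i)) =
    a i * \prod_j rising (add_ball a i j) (m j).
  apply: (prod_change_one (i := i)) => [|j /negbTE ji].
    by rewrite /add_ball eqxx addn1 risingS.
  by rewrite /add_ball ji addn0 addr0.
rewrite [X in _ * (X / _ * _)]sE [X in _ * (_ / X * _)]fE [X in _ * (_ / _ * X)]rE.
have : \prod_j (m j)`!%:R != 0 :> R.
  by rewrite prodf_seq_neq0; apply/allP => j _; rewrite pnatr_eq0 -lt0n fact_gt0.
have : (m i).+1%:R != 0 :> R by rewrite pnatr_eq0.
move: (\prod_j _) (\prod_j _) (\prod_j _) (_%:R) => P Q S M M0 Q0.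
by field; rewrite Q0 M0.
Qed.

(** Write the factor [n + 1] of the factorial as the sum of the entries of [m];
    lowering the [i]-th entry by one then amounts to drawing the colour [i]. *)
Lemma urn_multi_index n a s : (forall j, 0 < a j) ->
  urn a (nseq n s) = n`!%:R *
  \sum_(m : {ffun 'I_k -> 'I_n.+1} | (\sum_(j < k) m j)%N == n)
    multi_index_term a s (fun j => m j).
Proof.
elim: n a => [|n ih] a a0.
  rewrite (big_pred1 [ffun=> ord0]) => [|m /=]; last first.
    apply/eqP/eqP => [|->]; last by rewrite big1// => j _; rewrite ffunE.
    by move=> _; apply/ffunP => j; rewrite ffunE [LHS]ord1.
  rewrite /multi_index_term !big1 ?divr1 ?mulr1// => j _; rewrite ffunE ?rising0//.
rewrite /= factS natrM (mulrC _%:R) -mulrA.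
transitivity (\sum_i n`!%:R *
  \sum_(m : {ffun 'I_k -> 'I_n.+1} | (\sum_(j < k) m j)%N == n)
    a i * s i * multi_index_term (add_ball a i) s (fun j => m j)).
  apply: eq_bigr => i _; rewrite ih; last first.
    by move=> j; rewrite /add_ball ltr_pwDl.
  by rewrite mulrCA mulr_sumr.
have step i : \sum_(m : {ffun 'I_k -> 'I_n.+1} | (\sum_(j < k) m j)%N == n)
      a i * s i * multi_index_term (add_ball a i) s (fun j => m j) =
    \sum_(m : {ffun 'I_k -> 'I_n.+2} |
      ((\sum_(j < k) m j)%N == n.+1) && (0 < m i)%N)
      (m i)%:R * multi_index_term a s (fun j => m j).
  rewrite (multi_index_shift n i (fun m => (m i)%:R * multi_index_term a s m)).
  apply: eq_bigr => m _; rewrite -multi_index_term_add_ball// eqxx addn1.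
  by [].
rewrite -mulr_sumr; congr (_ * _); rewrite (eq_bigr _ (fun i _ => step i)).
under eq_bigr do rewrite big_mkcondr/=.
rewrite exchange_big/= mulr_sumr; apply: eq_bigr => m /eqP mn.
have -> : n.+1%:R = \sum_(i < k) (m i)%:R :> R by rewrite -natr_sum mn.
rewrite mulr_suml; apply: eq_bigr => i _.
by case: posnP => // ->; rewrite mul0r.
Qed.

End multi_index.

Theorem theorem3p3 (R : realType) (k : nat) (k_gt0 : (0 < k)%N)
    (alpha s : k.-tuple R) (alpha_gt0 : forall i : 'I_k, 0 < tnth alpha i)
    (n : nat) :
  let msum : R :=
    \sum_(m : {ffun 'I_k -> 'I_n.+1} | (\sum_(i < k) m i)%N == n)
      (\prod_(i < k) tnth s i ^+ m i) / (\prod_(i < k) (m i)`!)%N%:R *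
      \prod_(i < k) rising (tnth alpha i) (m i) in
  let c : R := n`!%:R / rising (\sum_(i < k) tnth alpha i) n in
  dirichlet_moment n s alpha = (c * msum)%:E /\
  c * msum =
    c * cycle_index n (fun j => \sum_(i < k) tnth s i ^+ j * tnth alpha i).
Proof.
move=> msum c.
have urnE := urn_multi_index n (tnth s) alpha_gt0.
have cE x : c * x = n`!%:R * x / rising (\sum_(i < k) tnth alpha i) n.
  by rewrite /c mulrAC.
split; rewrite !cE; last by rewrite cycle_index_urn urnE.
by rewrite dirichlet_moment_urn// urnE.
Qed.
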